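(* Assume that $\{x\in\mathbb{R}^n : \mathbf{P}(x\in\mathcal{X}_S)=1\}\neq\emptyset$. Then the following four problems are equivalent, in the sense that their solution sets coincide: (1) find a fixed point of the mapping $x\mapsto \mathbf{E}_{S\sim\mathbf{P}}[\Pi_{\mathcal{X}_S}(x)]$; (2) minimize over $x\in\mathbb{R}^n$ the function $f(x)=\mathbf{E}_{S\sim\mathbf{P}}[\mathbb{I}_{\mathcal{X}_S}(x)]$; (3) minimize over $x\in\mathbb{R}^n$ the function $F(x)=\frac12\mathbf{E}_{S\sim\mathbf{P}}[\|x-\Pi_{\mathcal{X}_S}(x)\|^2]$; (4) find $x\in\mathbb{R}^n$ such that $\mathbf{P}(x\in\mathcal{X}_S)=1$. That is, the set of fixed points of $x\mapsto \mathbf{E}_{S\sim\mathbf{P}}[\Pi_{\mathcal{X}_S}(x)]$ equals the set of minimizers of $f$, equals the set of minimizers of $F$, and equals the set $\{x : \mathbf{P}(x\in\mathcal{X}_S)=1\}$.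
   Context: $\mathcal{X}\subseteq\mathbb{R}^n$ is a nonempty closed convex set and $(\Omega,\mathbf{P})$ is a probability space with random variable $S\sim\mathbf{P}$. For every $S\in\Omega$, $\mathcal{X}_S$ is a random closed convex subset of $\mathbb{R}^n$ with $\mathcal{X}\subseteq\mathcal{X}_S$ (a ''stochastic approximation'' of $\mathcal{X}$); as part of ''random set'', $S\mapsto\Pi_{\mathcal{X}_S}(x)$ is measurable for each $x$. $\|\cdot\|$ is the Euclidean norm, $\Pi_C$ is the Euclidean projection onto a closed convex set $C$, and $\mathbb{I}_C$ is the indicator function with $\mathbb{I}_C(x)=0$ if $x\in C$ and $+\infty$ otherwise. *)

(* Defs.v *)
From HB Require Import structures.
From mathcomp Require Export all_boot all_order all_algebra.
From mathcomp Require Export all_classical all_reals all_analysis.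
Export Order.TTheory GRing.Theory Num.Theory.
Export numFieldNormedType.Exports.

Set Implicit Arguments.
Unset Strict Implicit.
Unset Printing Implicit Defensive.

Local Open Scope classical_set_scope.
Local Open Scope ring_scope.

(* The library's norm on ['rV[R]_n] is the sup norm, hence this definition.
   Both norms induce the topology used by [closed] and [open]. *)
Definition enorm (R : realType) (n : nat) (x : 'rV[R]_n) : R :=
  Num.sqrt (\sum_(i < n) x 0 i ^+ 2).

(* The default value 0 is irrelevant when C is nonempty, closed and convex:
   the nearest point then exists and is unique. *)
Definition proj (R : realType) (n : nat) (C : set 'rV[R]_n) (x : 'rV[R]_n) :
    'rV[R]_n :=
  xget 0 [set p | C p /\ forall q, C q -> enorm (x - p) <= enorm (x - q)].

Definition convex_indic (R : realType) (n : nat) (C : set 'rV[R]_n)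
    (x : 'rV[R]_n) : \bar R :=
  if x \in C then 0%E else +oo%E.

Definition borel_measurable (d : measure_display) (T : measurableType d)
    (R : realType) (n : nat) (Y : T -> 'rV[R]_n) : Prop :=
  measurable_fun [set: T] (Y : T -> g_sigma_algebraType (@open 'rV[R]_n)).

(* Meaningful when each coordinate of Y is integrable.  This is automatic for
   [Y s = proj (C s) x] if Y is measurable and the C s are closed, convex and
   share a point z, because then enorm (Y s - z) <= enorm (x - z). *)
Definition mean (d : measure_display) (T : measurableType d) (R : realType)
    (P : probability T R) (n : nat) (Y : T -> 'rV[R]_n) : 'rV[R]_n :=
  \row_(i < n) fine 'E_P[fun s => Y s 0 i].

Definition fixed_points (T : Type) (f : T -> T) : set T := [set x | f x = x].

Definition minimizers (T : Type) (R : realType) (f : T -> \bar R) : set T :=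
  [set x | forall y, (f x <= f y)%E].

(* Main.v *)
Require Import Defs.
From mathcomp Require Import measurable_realfun ring lra.

(* A point z of X lies in every X_S, so f(z) = F(z) = 0; hence the minimizers of
   the nonnegative f and F are their zeros, which are the almost surely feasible
   points.  For the fixed points, the variational inequality for projections
   gives |x - Pi_S x|^2 <= <x - Pi_S x, x - z>; if x = E[Pi_S x], the right-hand
   side has expectation 0, so F(x) = 0. *)

Local Open Scope classical_set_scope.
Local Open Scope ring_scope.

(** * The Euclidean norm and its comparison with coordinates and the sup norm *)

Lemma sqr_enorm {R : realType} {n : nat} (x : 'rV[R]_n) :
  enorm x ^+ 2 = \sum_(i < n) x 0 i ^+ 2.
Proof. by rewrite sqr_sqrtr// sumr_ge0// => i _; exact: sqr_ge0. Qed.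

Lemma enorm_ge0 {R : realType} {n : nat} (x : 'rV[R]_n) : 0 <= enorm x.
Proof. exact: sqrtr_ge0. Qed.

Lemma coord_le_enorm {R : realType} {n : nat} (x : 'rV[R]_n) (i : 'I_n) :
  `|x 0 i| <= enorm x.
Proof.
rewrite -sqrtr_sqr ler_wsqrtr// (bigD1 i)//= lerDl.
by apply: sumr_ge0 => j _; exact: sqr_ge0.
Qed.

Lemma enorm_eq0 {R : realType} {n : nat} (x : 'rV[R]_n) :
  enorm x = 0 -> x = 0.
Proof.
move=> x0; apply/rowP => i; rewrite mxE; apply/eqP.
by rewrite -normr_le0 -x0 coord_le_enorm.
Qed.

Lemma enorm0 {R : realType} {n : nat} : enorm (0 : 'rV[R]_n) = 0.
Proof. by rewrite /enorm big1 ?sqrtr0// => i _; rewrite mxE expr0n. Qed.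

(** Carries Euclidean bounds over to the sup norm, in which [bounded_closed_compact] measures
    boundedness. *)
Lemma normr_le_enorm {R : realType} {n : nat} (x : 'rV[R]_n) : `|x| <= enorm x.
Proof.
rewrite [leLHS]/Num.norm/= mx_normrE; apply/bigmax_leP; split=> [|[i j] _].
  exact: enorm_ge0.
by rewrite ord1 coord_le_enorm.
Qed.

(** * Nearest points and the variational inequality *)

Lemma sum_continuous {T : topologicalType} {R : realType} {I : Type}
    (r : seq I) (f : I -> T -> R) :
  (forall i, continuous (f i)) -> continuous (fun t => \sum_(i <- r) f i t).
Proof.
move=> cf t; elim: r => [|i r IHr].
  by under eq_fun do rewrite big_nil; exact: cst_continuous.
by under eq_fun do rewrite big_cons; apply: continuousD => //; exact: cf.
Qed.

Lemma enorm_dist_continuous {R : realType} {n : nat} (x : 'rV[R]_n) :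
  continuous (fun p : 'rV[R]_n => enorm (x - p)).
Proof.
move=> p; apply: (@continuous_comp _ _ _ (fun q : 'rV[R]_n => \sum_(i < n) (x - q) 0 i ^+ 2)
  Num.sqrt); last exact: sqrt_continuous.
apply: sum_continuous => i {}p.
apply: (@continuous_comp _ _ _ (fun q : 'rV[R]_n => (x - q) 0 i) (fun r => r ^+ 2)).
  have -> : (fun q : 'rV[R]_n => (x - q) 0 i) = (fun q => x 0 i - q 0 i).
    by apply/funext => q; rewrite !mxE.
  by apply: continuousB; [exact: cst_continuous|exact: coord_continuous].
exact: exprn_continuous.
Qed.

(** Only points of [C] no farther from [x] than a chosen [z] in [C] compete. They form a compact
    set, on which the continuous distance to [x] attains its minimum. *)
Lemma nearest_point_exists {R : realType} {n : nat} {C : set 'rV[R]_n}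
    (x : 'rV[R]_n) : closed C -> C !=set0 ->
  exists p, C p /\ forall q, C q -> enorm (x - p) <= enorm (x - q).
Proof.
move=> cC [z Cz].
pose B := C `&` [set p | enorm (x - p) <= enorm (x - z)].
have cB : compact B.
  apply: bounded_closed_compact.
    (* The bound comes from [p = x - (x - p)] and the triangle inequality. *)
    exists (enorm (x - z) + `|x|); split; first exact: num_real.
    move=> M /ltW xzM p [_ /= pB]; apply: le_trans xzM.
    rewrite -[p](subKr x) (le_trans (ler_normB _ _))// [leLHS]addrC lerD2r.
    by apply: le_trans pB; exact: normr_le_enorm.
  apply: closedI => //.
  apply: (preimage_closed _ (@closed_le _ _)) => p _.
  exact: enorm_dist_continuous.
have [||p] := @compact_EVT_min _ _ (fun p : 'rV[R]_n => enorm (x - p)) B _ cB.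
- by exists z; split => /=.
- by apply: continuous_subspaceT => p; exact: enorm_dist_continuous.
rewrite inE => -[Cp pz] pmin; exists p; split=> // q Cq.
have [qz|/ltW qz] := leP (enorm (x - q)) (enorm (x - z)).
  by apply: pmin; rewrite inE.
exact: le_trans qz.
Qed.

(** A nearest point exists, so [xget] returns one instead of its default 0. *)
Lemma projP {R : realType} {n : nat} {C : set 'rV[R]_n} (x : 'rV[R]_n) :
  closed C -> C !=set0 ->
  C (proj C x) /\ forall q, C q -> enorm (x - proj C x) <= enorm (x - q).
Proof.
move=> cC C0; have [p Hp] := nearest_point_exists x cC C0.
by rewrite /proj; case: xgetP => [_ _ //|none]; case: (none p Hp).
Qed.

Lemma proj_id {R : realType} {n : nat} {C : set 'rV[R]_n} (x : 'rV[R]_n) :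
  closed C -> C !=set0 -> (proj C x = x) <-> C x.
Proof.
move=> cC C0; have [Cp pmin] := projP x cC C0; split=> [<-//|Cx].
apply/esym/eqP; rewrite -subr_eq0; apply/eqP/enorm_eq0/eqP.
by rewrite eq_le enorm_ge0 andbT (le_trans (pmin _ Cx))// subrr enorm0.
Qed.

(* Compare [p = proj C x] with the points [t z + (1 - t) p] of C as [t -> 0+]. *)
Lemma proj_variational {R : realType} {n : nat} {C : set 'rV[R]_n}
    (x : 'rV[R]_n) {z : 'rV[R]_n} : closed C -> convex_set C -> C z ->
  \sum_(i < n) (x - proj C x) 0 i * (z - proj C x) 0 i <= 0.
Proof.
move=> cC vC Cz; have C0 : C !=set0 by exists z.
have [Cp pmin] := projP x cC C0; set p := proj C x in Cp pmin *.
set A := (X in X <= 0); pose B := \sum_(i < n) (z - p) 0 i ^+ 2.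
have B0 : 0 <= B by apply: sumr_ge0 => i _; exact: sqr_ge0.
have AB (t : R) : 0 <= t -> t <= 1 -> 2 * t * A <= t ^+ 2 * B.
  move=> t0 t1.
  have Cq : C (t *: z + (1 - t) *: p).
    (* [convex_set] takes its coefficient in an interval type, so [t] must be packaged with a proof
       that it lies in [0, 1]. *)
    have t01 : Itv.spec (Itv.num_sem (R := R)) (Itv.Real `[0%Z, 1%Z]) t.
      by apply/andP; split; rewrite ?num_real// in_itv/= t0 t1.
    have := vC z p (Itv.mk t01).
    by rewrite !inE; apply.
  have := pmin _ Cq.
  rewrite -(ler_pXn2r (n := 2))// ?nnegrE ?enorm_ge0// !sqr_enorm.
  (* This expands the square of [(x - p) - t (z - p)]; minimality of [p] then leaves exactly the
     claimed bound. *)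
  suff -> : \sum_(i < n) (x - (t *: z + (1 - t) *: p)) 0 i ^+ 2 =
     \sum_(i < n) (x - p) 0 i ^+ 2 - 2 * t * A + t ^+ 2 * B by lra.
  rewrite /A /B !mulr_sumr -sumrB -big_split/=; apply: eq_bigr => i _.
  by rewrite !mxE; ring.
(* If [A > 0], the explicit value [t = A / (A + B)] replaces a limit: it lies in [0, 1] even when
   [B = 0]. Clearing denominators in [AB] gives [2 A^3 + A^2 B <= 0], which is absurd. *)
rewrite leNgt; apply/negP => A0.
have AB0 : 0 < A + B by lra.
have t0 : 0 <= A / (A + B) by rewrite divr_ge0// ltW.
have t1 : A / (A + B) <= 1 by rewrite ler_pdivrMr// mul1r lerDl.
have := AB _ t0 t1.
have -> : 2 * (A / (A + B)) * A = (2 * A ^+ 2 * (A + B)) / (A + B) ^+ 2.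
  by field; rewrite gt_eqF.
have -> : (A / (A + B)) ^+ 2 * B = (A ^+ 2 * B) / (A + B) ^+ 2.
  by field; rewrite gt_eqF.
rewrite ler_pM2r ?invr_gt0 ?exprn_gt0//.
have : 0 < A ^+ 2 * A by rewrite mulr_gt0 ?exprn_gt0.
have : 0 <= A ^+ 2 * B by rewrite mulr_ge0 ?sqr_ge0.
lra.
Qed.

(** Writing [p] for the projection and splitting [x - z] as [(x - p) + (p - z)], this is the
    variational inequality. The bound is affine in [p], so its expectation depends only on the mean
    projection. *)
Lemma sqr_dist_proj_le {R : realType} {n : nat} {C : set 'rV[R]_n}
    (x : 'rV[R]_n) {z : 'rV[R]_n} : closed C -> convex_set C -> C z ->
  enorm (x - proj C x) ^+ 2 <=
  \sum_(i < n) (x 0 i - proj C x 0 i) * (x 0 i - z 0 i).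
Proof.
move=> cC vC Cz; rewrite sqr_enorm -subr_ge0 -sumrB.
rewrite -oppr_le0 -sumrN; apply: le_trans (proj_variational x cC vC Cz).
by rewrite le_eqVlt; apply/orP; left; apply/eqP/eq_bigr => i _; rewrite !mxE; ring.
Qed.

(** * Zero minima, vanishing integrals and measurability *)

Lemma minimizers_ge0 {T : Type} {R : realType} (f : T -> \bar R) (z : T) :
  (forall x, 0 <= f x)%E -> f z = 0%E -> minimizers f = [set x | f x = 0%E].
Proof.
move=> f0 fz; apply/seteqP; split=> x /= => [xmin|fx0 y]; last by rewrite fx0.
by apply/eqP; rewrite eq_le f0 andbT -fz.
Qed.

(** A nonnegative integrand has integral 0 exactly when it vanishes almost everywhere, and here it
    is nonzero exactly on the complement of [A]. Applied to both [f] and [F]. *)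
Lemma integral_eq0_prob1 {d : measure_display} {T : measurableType d}
    {R : realType} {P : probability T R} {A : set T} {g : T -> \bar R} :
  measurable A -> measurable_fun setT g -> (forall s, 0 <= g s)%E ->
  (forall s, g s = 0%E <-> A s) ->
  (\int[P]_s g s = 0)%E <-> P A = 1%E.
Proof.
move=> mA mg g0 gA.
have -> : (\int[P]_s g s = \int[P]_s `|g s|)%E.
  by apply: eq_integral => s _; rewrite gee0_abs.
have PAC : P A = 1%E <-> P (~` A) = 0%E.
  rewrite probability_setC//; split=> [->|]; first by rewrite subee.
  have := fin_num_measure P _ mA.
  by case: (P A) => // r _ [/eqP]; rewrite subr_eq0 => /eqP <-.
rewrite PAC; split=> [/(ae_eq_integral_abs P measurableT mg)[N [mN N0 sN]]|PA0].
  apply/eqP; rewrite -measure_le0 -N0 le_measure ?inE//; first exact: measurableC.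
  by move=> s nAs; apply: sN => /= /(_ I) /gA.
apply/(ae_eq_integral_abs P measurableT mg).
exists (~` A); split=> //; first exact: measurableC.
by move=> s /= ngs As; apply: ngs => _; apply/gA.
Qed.

(** Open intervals generate the Borel sets of the line, and their preimages under a continuous
    coordinate are open. *)
Lemma borel_measurable_coord {d : measure_display} {T : measurableType d}
    {R : realType} {n : nat} {Y : T -> 'rV[R]_n} (i : 'I_n) :
  borel_measurable Y -> measurable_fun setT (fun s => Y s 0 i).
Proof.
move=> mY; apply: (measurability _ (RGenOpens.measurableE R)).
move=> _ [_ [a [b ->] <-]].
apply: (mY measurableT ((fun v : 'rV[R]_n => v 0 i) @^-1` `]a, b[%classic)).
apply: sub_sigma_algebra; apply: open_comp; last exact: interval_open.
by move=> v _; exact: coord_continuous.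
Qed.

(** * Comparison of the other three solution sets with the almost surely feasible points *)

Theorem lemma1 (R : realType) (n : nat) (d : measure_display)
    (Omega : measurableType d) (P : probability Omega R)
    (X : set 'rV[R]_n) (XS : Omega -> set 'rV[R]_n)
    (X_nonempty : X !=set0) (X_closed : closed X) (X_convex : convex_set X)
    (XS_closed : forall s, closed (XS s))
    (XS_convex : forall s, convex_set (XS s))
    (X_sub_XS : forall s, X `<=` XS s)
    (proj_measurable : forall x, borel_measurable (fun s => proj (XS s) x))
    (feasible : [set x | P [set s | XS s x] = 1%E] !=set0) :
  let fixpts := fixed_points (fun x : 'rV[R]_n => mean P (fun s => proj (XS s) x)) in
  let argmin_f := minimizers (fun x : 'rV[R]_n => (\int[P]_s convex_indic (XS s) x)%E) in
  let argmin_F := minimizers (fun x : 'rV[R]_n =>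
    ((2^-1)%:E * 'E_P[fun s => (enorm (x - proj (XS s) x) ^+ 2)%R])%E) in
  let feas := [set x | P [set s | XS s x] = 1%E] in
  [/\ fixpts = argmin_f, argmin_f = argmin_F & argmin_F = feas].
Proof.
move=> fixpts argmin_f argmin_F feas.
have [z Xz] := X_nonempty.
have XSz s : XS s z by exact: X_sub_XS.
have XS0 s : XS s !=set0 by exists z.
have mproj x i : measurable_fun setT (fun s => proj (XS s) x 0 i).
  exact: (borel_measurable_coord i (proj_measurable x)).
have msq x : measurable_fun setT (fun s => enorm (x - proj (XS s) x) ^+ 2).
  under eq_fun do rewrite sqr_enorm.
  apply: measurable_sum => i; apply: measurable_funX.
  under eq_fun do rewrite !mxE.
  exact: measurable_funB.
have sq0 x s : enorm (x - proj (XS s) x) ^+ 2 = 0 <-> XS s x.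
  rewrite -(proj_id x (XS_closed s) (XS0 s)); split=> [/eqP|->].
    by rewrite sqrf_eq0 => /eqP/enorm_eq0/eqP; rewrite subr_eq0 => /eqP.
  by rewrite subrr enorm0 expr0n.
(* The feasibility event is the zero set of the measurable squared distance. *)
have mXS x : measurable [set s | XS s x].
  rewrite (_ : [set s | _] =
    (fun s => enorm (x - proj (XS s) x) ^+ 2) @^-1` [set 0]); last first.
    by apply/seteqP; split=> s /= /sq0.
  by rewrite -[X in measurable X]setTI; apply: msq.
have indic_ge0 x s : (0 <= convex_indic (XS s) x :> \bar R)%E.
  by rewrite /convex_indic; case: ifP.
have indic0 x s : convex_indic (XS s) x = 0%E :> \bar R <-> XS s x.
  rewrite /convex_indic; case: ifPn; first by rewrite inE.
  by rewrite notin_setE; split.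
have mindic x : measurable_fun setT (fun s => convex_indic (XS s) x : \bar R).
  apply: measurable_fun_ifT => //.
  apply: (measurable_fun_bool true).
  rewrite setTI (_ : _ @^-1` _ = [set s | XS s x])//.
  by apply/seteqP; split=> s; [exact: set_mem|exact: mem_set].
have fE x : (\int[P]_s convex_indic (XS s) x = 0)%E <-> feas x.
  exact: (integral_eq0_prob1 (mXS x) (mindic x) (indic_ge0 x) (indic0 x)).
have FE x : (\int[P]_s (enorm (x - proj (XS s) x) ^+ 2)%:E = 0)%E <-> feas x.
  apply: (integral_eq0_prob1 (mXS x)).
  - exact/measurable_EFinP.
  - by move=> s; rewrite lee_fin sqr_ge0.
  - by move=> s; rewrite /= -sq0; split=> [[]|->].
have feasz : feas z.
  rewrite /feas/= (_ : [set s | _] = setT) ?probability_setT//.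
  by apply/seteqP; split=> s _ /=.
have argmin_fE : argmin_f = feas.
  rewrite /argmin_f (@minimizers_ge0 _ _ _ z); last exact/fE.
    by apply/seteqP; split=> x /fE.
  by move=> x; exact: integral_ge0.
have argmin_FE : argmin_F = feas.
  rewrite /argmin_F (@minimizers_ge0 _ _ _ z).
  - apply/seteqP; split=> x /=; rewrite unlock.
      by move=> /eqP; rewrite mule_eq0 eqe invr_eq0 pnatr_eq0/= => /eqP/FE.
    by move=> /FE ->; rewrite mule0.
  - move=> x; rewrite mule_ge0// ?lee_fin ?invr_ge0//.
    by apply: expectation_ge0 => s; exact: sqr_ge0.
  - by rewrite unlock (FE z).2 ?mule0.
rewrite argmin_fE argmin_FE; split=> //.
have intcst (r : R) : (\int[P]_s r%:E = r%:E)%E.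
  by have := expectation_cst P r; rewrite unlock.
(* Since [z] lies in every [XS s], the projection stays within [enorm (x - z)] of [x], uniformly in
   [s]; bounded measurable functions are integrable for a probability. *)
have iproj x i : P.-integrable setT (fun s => (proj (XS s) x 0 i)%:E).
  apply: measurable_bounded_integrable => //.
    by rewrite -ge0_fin_numE //; exact: fin_num_measure.
  exists (enorm (x - z) + `|x 0 i|); split; first exact: num_real.
  move=> M /ltW zM s _; apply: le_trans zM.
  rewrite -[proj _ _ _ _](subKr (x 0 i)) (le_trans (ler_normB _ _))// [leLHS]addrC.
  rewrite lerD2r.
  have := coord_le_enorm (x - proj (XS s) x) i; rewrite !mxE => /le_trans; apply.
  by have [_] := projP x (XS_closed s) (XS0 s); apply.
apply/seteqP; split=> x; rewrite /fixpts/=.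
  move=> xfix; apply/FE.
  pose D i s := x 0 i - proj (XS s) x 0 i.
  have iD i : P.-integrable setT (EFin \o D i).
    rewrite (_ : _ \o _ = (fun s => (x 0 i)%:E - (proj (XS s) x 0 i)%:E)%E)//.
    apply: integrableB => //.
    exact: finite_measure_integrable_cst.
  have D0 i : (\int[P]_s (D i s)%:E = 0)%E.
    rewrite /D; under eq_integral do rewrite EFinB.
    rewrite integralB_EFin//; last 2 first.
    - exact: finite_measure_integrable_cst.
    - exact: iproj.
    rewrite intcst.
    have /rowP/(_ i) := xfix; rewrite mxE unlock => xi.
    (* Integrability makes the expectation finite, so the [fine] inside [mean] loses nothing. *)
    rewrite -(fineK (integrable_fin_num _ (iproj x i)))//.
    by rewrite [X in (_ - X%:E)%E]xi subee.
  apply/eqP; rewrite eq_le integral_ge0 ?andbT; last first.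
    by move=> s _; rewrite lee_fin sqr_ge0.
  (* The weights [x 0 i - z 0 i] do not depend on [s], so 0 is the expectation of the upper bound in
     [sqr_dist_proj_le]. *)
  have -> : 0%E = (\int[P]_s (\sum_(i < n) (x 0 i - z 0 i)%:E * (D i s)%:E))%E.
    rewrite integral_sum//.
      by rewrite big1// => i _; rewrite (integralZl _ (iD i))// D0 mule0.
    by move=> i; apply: integrableZl => //; exact: iD.
  have le s : ((enorm (x - proj (XS s) x) ^+ 2)%:E <=
      \sum_(i < n) (x 0 i - z 0 i)%:E * (D i s)%:E)%E.
    under eq_bigr do rewrite -EFinM mulrC.
    rewrite sumEFin lee_fin.
    exact: sqr_dist_proj_le.
  apply: ge0_le_integral => //.
  - by move=> s _; rewrite lee_fin sqr_ge0.
  - exact/measurable_EFinP.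
  - apply: emeasurable_sum => i.
    exact: measurable_int (integrableZl measurableT _ (iD i)).
(* Conversely, for an almost surely feasible [x] the projection equals [x] off a null event, so each
   coordinate has mean [x 0 i]. *)
move=> fx; apply/rowP => i; rewrite mxE unlock.
rewrite (ae_eq_integral (cst (x 0 i)%:E))//.
- by rewrite /= intcst.
- exact/measurable_EFinP.
exists (~` [set s | XS s x]); split.
- exact: measurableC.
- by have := probability_setC P (mXS x); rewrite fx subee.
- move=> s /= ns Xs; apply: ns => _.
  by rewrite (proj_id x (XS_closed s) (XS0 s)).2.
Qed.
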